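(* Let $\Delta$ be a simplicial complex with vertex set $V(\Delta)=\{x_1,\dots,x_n\}$ and let $s_1,\dots,s_n$ be positive integers. Then $\Delta$ is vertex decomposable if and only if its $(s_1,\dots,s_n)$-expansion $\Delta^{(s_1,\dots,s_n)}$ is vertex decomposable.
   Context: Simplicial complexes are finite; $\mathcal{F}(\Delta)$ denotes the set of facets (maximal faces) of $\Delta$, and $[s]=\{1,\dots,s\}$. Expansion: for a simplicial complex $\Delta$ with vertex set $\{x_1,\dots,x_n\}$ and positive integers $s_1,\dots,s_n$, the $(s_1,\dots,s_n)$-expansion $\Delta^{(s_1,\dots,s_n)}$ is the simplicial complex with vertex set $\{x_{11},\dots,x_{1s_1},x_{21},\dots,x_{2s_2},\dots,x_{n1},\dots,x_{ns_n}\}$ whose facets are exactly the sets $\{x_{i_1r_1},\dots,x_{i_kr_k}\}$ where $\{x_{i_1},\dots,x_{i_k}\}\in\mathcal{F}(\Delta)$ with $i_1<\cdots<i_k$ and $(r_1,\dots,r_k)\in[s_{i_1}]\times\cdots\times[s_{i_k}]$. For a face $F\in\Delta$, the link is $\mathrm{lk}_\Delta(F)=\{G\in\Delta: G\cap F=\emptyset,\ G\cup F\in\Delta\}$ and the deletion is $\mathrm{del}_\Delta(F)=\{G\in\Delta: G\cap F=\emptyset\}$; for a vertex $x$ one writes $\mathrm{lk}_\Delta(x)$, $\mathrm{del}_\Delta(x)$ for $F=\{x\}$. Vertex decomposable (recursive definition, non-pure): $\Delta$ is vertex decomposable if $\Delta$ is a simplex, or $\Delta$ contains a vertex $x$ such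 that (i) both $\mathrm{del}_\Delta(x)$ and $\mathrm{lk}_\Delta(x)$ are vertex decomposable, and (ii) every facet of $\mathrm{del}_\Delta(x)$ is a facet of $\Delta$. *)

(* Defs.v *)
From mathcomp Require Import all_boot.

Set Implicit Arguments.
Unset Strict Implicit.
Unset Printing Implicit Defensive.

(* A simplicial complex is given by its set of faces over an ambient finite
   type V; V may be larger than the vertex set, so that links and deletions
   live over the same type. *)
Definition simplicial_complex (V : finType) (D : {set {set V}}) : Prop :=
  set0 \in D /\ forall F G : {set V}, F \in D -> G \subset F -> G \in D.

Definition vertices (V : finType) (D : {set {set V}}) : {set V} :=
  [set x | [set x] \in D].

Definition facets (V : finType) (D : {set {set V}}) : {set {set V}} :=
  [set F | maxset (fun G => G \in D) F].

Definition link (V : finType) (D : {set {set V}}) (F : {set V}) :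
    {set {set V}} :=
  [set G in D | (G :&: F == set0) && (G :|: F \in D)].

Definition deletion (V : finType) (D : {set {set V}}) (F : {set V}) :
    {set {set V}} :=
  [set G in D | G :&: F == set0].

(* The complex {set0} is a simplex; the void complex is not. *)
Definition simplex (V : finType) (D : {set {set V}}) : Prop :=
  exists F : {set V}, D = powerset F.

Inductive vertex_decomposable (V : finType) (D : {set {set V}}) : Prop :=
| vd_simplex of simplex D
| vd_shedding (x : V) of
    x \in vertices D
  & vertex_decomposable (deletion D [set x])
  & vertex_decomposable (link D [set x])
  & facets (deletion D [set x]) \subset facets D.

Section Expansion.

Variables (V : finType) (s : V -> nat).

(* x_ij is the pair of i and j : 'I_(s i), with j counted from 0. *)
Definition expansion_vertex : finType := {i : V & 'I_(s i)}.

Definition lift_face (r : {dffun forall i : V, 'I_(s i)}) (F : {set V}) :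
    {set expansion_vertex} :=
  [set Tagged (fun i => 'I_(s i)) (r i) | i in F].

(* The choices r range over all of V rather than over F only; as every s i is
   positive, each choice on F extends to V, so the same sets are obtained. *)
Definition expansion_facets (D : {set {set V}}) :
    {set {set expansion_vertex}} :=
  [set lift_face r F | F in facets D,
                       r in [set: {dffun forall i : V, 'I_(s i)}]].

Definition expansion (D : {set {set V}}) : {set {set expansion_vertex}} :=
  [set G : {set expansion_vertex} | [exists F in expansion_facets D,
                                       G \subset F]].

Lemma tag_lift_face r F : [set tag u | u in lift_face r F] = F.
Proof.
apply/setP=> i; apply/imsetP/idP => [[u /imsetP[j jF ->] ->] //|iF].
by exists (Tagged (fun i => 'I_(s i)) (r i)) => //; apply/imsetP; exists i.
Qed.

Lemma card_lift_face r F : #|lift_face r F| = #|F|.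
Proof. by apply: card_imset => i j /(congr1 tag). Qed.

Lemma facets_expansion (D : {set {set V}}) :
  facets (expansion D) = expansion_facets D.
Proof.
apply/setP=> G; rewrite inE; apply/idP/idP.
  move=> /maxsetP[]; rewrite inE => /existsP[F /andP[FD GF]] maxG.
  rewrite -(maxG F) // inE; apply/existsP; exists F; by rewrite FD /=.
move=> GD; apply/maxsetP; split.
  by rewrite inE; apply/existsP; exists G; rewrite GD /=.
move=> H; rewrite inE => /existsP[K /andP[KD HK]] GH.
apply/eqP; rewrite eq_sym eqEsubset GH /=.
have GK := subset_trans GH HK.
suff -> : G = K by [].
case/imset2P: GD GK {GH HK} => F r FD _ -> GK.
case/imset2P: KD GK => F' r' F'D _ -> GK.
have FF' : F \subset F'.
  by rewrite -(tag_lift_face r F) -(tag_lift_face r' F'); apply: imsetS.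
move: FD F'D; rewrite !inE => /maxsetP[_ maxF] /maxsetP[F'D _].
have eFF := maxF _ F'D FF'.
by apply/eqP; rewrite eqEcard GK !card_lift_face eFF leqnn.
Qed.

End Expansion.

(* Main.v *)
Require Import Defs.
From mathcomp Require Import all_boot.

(** Generalize the expansion to a map [f : W -> V] and a set [A] of admissible
    vertices: the faces are the subsets of [A] that [f] maps injectively onto
    faces of [D].  Deleting a vertex [y] shrinks [A], and the link of [y] is the
    expansion of the link of [f y].  If the fibre of [f y] in [A] has another
    point, then deleting [y] gives another expansion of the same [D], and [y] is
    a shedding vertex as soon as the two parts are vertex decomposable;
    otherwise the deletion of [y] is the expansion of the deletion of [f y], and
    [y] is a shedding vertex exactly when [f y] is.  Both implications follow by
    induction. *)

Set Implicit Arguments.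
Unset Strict Implicit.
Unset Printing Implicit Defensive.

(** * Deletions, links and simplices *)

Section Complexes.

Variable V : finType.
Implicit Types (D : {set {set V}}) (F : {set V}) (x : V).

Lemma simplicial_complex_deletion D F :
  simplicial_complex D -> simplicial_complex (deletion D F).
Proof.
move=> [D0 Dsub]; split; first by rewrite inE D0 set0I eqxx.
move=> G H; rewrite !inE => /andP[GD /eqP GF] HG; rewrite (Dsub G) //=.
by rewrite -subset0 -GF setSI.
Qed.

Lemma simplicial_complex_link D F :
  simplicial_complex D -> F \in D -> simplicial_complex (link D F).
Proof.
move=> [D0 Dsub] FD; split; first by rewrite inE D0 set0I eqxx set0U.
move=> G H; rewrite !inE => /and3P[GD /eqP GF GFD] HG.
rewrite (Dsub G H) // (Dsub (G :|: F) (H :|: F)) ?setSU // andbT /=.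
by rewrite -subset0 -GF setSI.
Qed.

Lemma vertices_sub D D' : D \subset D' -> vertices D \subset vertices D'.
Proof.
by move=> sDD'; apply/subsetP=> x; rewrite !inE; apply: (subsetP sDD').
Qed.

Lemma link_sub D F : link D F \subset D.
Proof. by apply/subsetP=> G; rewrite inE => /andP[]. Qed.

Lemma face_sub_vertices D F :
  simplicial_complex D -> F \in D -> F \subset vertices D.
Proof.
by move=> [_ Dsub] FD; apply/subsetP=> x xF; rewrite inE (Dsub F) ?sub1set.
Qed.

Lemma simplicial_complex_powerset F : simplicial_complex (powerset F).
Proof.
split=> [|G H]; rewrite !inE ?sub0set // => GF HG.
exact: subset_trans GF.
Qed.

Lemma vertices_powerset F : vertices (powerset F) = F.
Proof. by apply/setP=> x; rewrite !inE sub1set. Qed.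

Lemma setI1_eq0 F x : (F :&: [set x] == set0) = (x \notin F).
Proof. by rewrite setI_eq0 disjoint_sym disjoints1. Qed.

Lemma link_powerset F x :
  x \in F -> link (powerset F) [set x] = powerset (F :\ x).
Proof.
move=> xF; apply/setP=> G.
rewrite !inE setI1_eq0 subUset sub1set xF andbT subsetD1.
by case: (G \subset F); rewrite ?andbT.
Qed.

End Complexes.

(** * Expansions along a map, relative to a set of admissible points *)

Section Blowup.

Variables (W V : finType) (f : W -> V).
Implicit Types (A G : {set W}) (D : {set {set V}}) (F : {set V}).

(** The equality of cardinals is injectivity of [f] on [G] in boolean form. Points of [A] over no
    vertex of [D] are allowed; they lie in no face, so a link changes [D] while [A] stays fixed. *)
Definition blowup A D : {set {set W}} :=
  [set G : {set W} | [&& G \subset A, #|f @: G| == #|G| & f @: G \in D]].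

Lemma blowupP A D G :
  reflect [/\ G \subset A, {in G &, injective f} & f @: G \in D]
          (G \in blowup A D).
Proof.
rewrite inE; apply: (iffP and3P) => [[GA /imset_injP inj GD] //|[GA inj GD]].
by split=> //; apply/imset_injP.
Qed.

(** Take [H] maximal among the subsets of [A] containing [G] that [f] maps injectively into [F]: a
    point of [F] missed by [H] would have a preimage in [A] that could be added. *)
Lemma extend_transversal A G F :
    G \subset A -> {in G &, injective f} -> f @: G \subset F ->
    F \subset f @: A ->
  exists H : {set W},
    [/\ G \subset H, H \subset A, {in H &, injective f} & f @: H = F].
Proof.
move=> GA inj GF FA.
pose P (H : {set W}) := [&& H \subset A, #|f @: H| == #|H| & f @: H \subset F].
have [|H /maxsetP[/and3P[HA /imset_injP injH HF] maxH] GH] :=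
    @maxset_exists _ P G.
  by rewrite /P GA GF andbT; apply/imset_injP.
exists H; split=> //; apply/eqP; rewrite eqEsubset HF.
apply/subsetP=> x xF; apply: contraT => xH.
have /imsetP[y yA xy] := subsetP FA _ xF.
have yH : y \notin H by apply: contra xH => yH; rewrite xy imset_f.
have := maxH (y |: H); rewrite /P subUset sub1set yA HA imsetU1 -xy.
rewrite !cardsU1 xH yH (card_in_imset injH) eqxx subUset sub1set xF HF subsetUr.
by move=> /(_ isT isT) eH; rewrite -eH setU11 in yH.
Qed.

(** As [A] covers the vertices of [D], any face of [D] above [f @: G] lifts to a face above [G].
    Conversely, a face above [G] with the same image has the same cardinality by injectivity. *)
Lemma blowup_facetP A D G : simplicial_complex D -> vertices D \subset f @: A ->
  reflect [/\ G \subset A, {in G &, injective f} & f @: G \in facets D]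
          (G \in facets (blowup A D)).
Proof.
move=> Dc DA; rewrite [_ \in facets (blowup _ _)]inE.
apply: (iffP maxsetP) => [[/blowupP[GA inj GD] maxG]|[GA inj]].
  split=> //; rewrite inE; apply/maxsetP; split=> // F FD GF.
  have FA : F \subset f @: A := subset_trans (face_sub_vertices Dc FD) DA.
  have [H [GH HA injH HF]] := extend_transversal GA inj GF FA.
  by rewrite -HF (maxG H) //; apply/blowupP; rewrite HF.
rewrite inE => /maxsetP[GD maxG]; split; first exact/blowupP.
move=> H /blowupP[HA injH HD] GH; apply/eqP; rewrite eq_sym eqEcard GH /=.
by rewrite -(card_in_imset injH) (maxG _ HD) ?imsetS // leq_imset_card.
Qed.

Lemma deletion_blowup A D y : deletion (blowup A D) [set y] = blowup (A :\ y) D.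
Proof.
apply/setP=> G; rewrite !inE setI1_eq0 subsetD1.
by case: (y \in G); rewrite ?andbT ?andbF.
Qed.

Lemma blowup_deletion A D x :
  x \notin f @: A -> blowup A (deletion D [set x]) = blowup A D.
Proof.
move=> xA; apply/setP=> G; rewrite !inE setI1_eq0.
case GA: (G \subset A) => //=.
have -> : x \notin f @: G by apply: contra xA => /(subsetP (imsetS f GA)).
by rewrite andbT.
Qed.

(** Injectivity on [y |: G] with [y] outside [G] means that [f y] is not in [f @: G], which is the
    disjointness condition of the link downstairs. *)
Lemma link_blowup A D y : simplicial_complex D -> y \in A ->
  link (blowup A D) [set y] = blowup A (link D [set f y]).
Proof.
move=> [_ Dsub] yA; apply/setP=> G; apply/idP/blowupP.
  rewrite inE => /and3P[/blowupP[GA inj GD]].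
  rewrite setI1_eq0 => yG /blowupP[_ injU UD]; split=> //.
  rewrite inE GD setI1_eq0 -(imset_set1 f) -imsetU UD andbT /=.
  apply/imsetP=> -[z zG /injU yz]; move: yG; rewrite yz ?zG //.
    by rewrite !inE eqxx orbT.
  by rewrite inE zG.
case=> GA inj; rewrite inE setI1_eq0 => /and3P[GD yfG UD].
have yG : y \notin G by apply: contra yfG; apply: imset_f.
rewrite inE setI1_eq0 yG; apply/andP; split; first exact/blowupP.
rewrite inE subUset GA sub1set yA imsetU imset_set1 UD andbT /=.
by rewrite setUC (setUC G) !cardsU1 yfG yG (card_in_imset inj) eqxx.
Qed.

Lemma vertex_blowup A D y : y \in A ->
  (y \in vertices (blowup A D)) = (f y \in vertices D).
Proof. by move=> yA; rewrite !inE sub1set yA imset_set1 !cards1. Qed.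

Lemma imset_fibre A y : f y \in f @: (A :\ y) -> f @: (A :\ y) = f @: A.
Proof.
move=> fy; apply/eqP; rewrite eqEsubset imsetS ?subsetDl //=.
apply/subsetP=> _ /imsetP[z zA ->]; have [-> //|zy] := eqVneq z y.
by rewrite imset_f // !inE zy.
Qed.

Lemma vertices_deletion_sub A D y : vertices D \subset f @: A ->
  vertices (deletion D [set f y]) \subset f @: (A :\ y).
Proof.
move=> DA; apply/subsetP=> z; rewrite !inE setI1_eq0 inE => /andP[zD zy].
have : z \in vertices D by rewrite inE.
move=> /(subsetP DA)/imsetP[w wA zw]; rewrite zw imset_f // !inE wA andbT.
by apply: contra zy => /eqP wy; rewrite zw wy.
Qed.

(** With a twin of [y] left, [A :\ y] still covers the vertices of [D], so [blowup_facetP] describes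
    the facets before and after the deletion by the same condition on [f @: G]. *)
Lemma blowup_shed_twin A D y :
    simplicial_complex D -> vertices D \subset f @: A ->
    y \in A -> f y \in vertices D -> f y \in f @: (A :\ y) ->
    vertex_decomposable (blowup (A :\ y) D) ->
    vertex_decomposable (blowup A (link D [set f y])) ->
  vertex_decomposable (blowup A D).
Proof.
move=> Dc DA yA yD tw vd_del vd_lk; apply: (@vd_shedding _ _ y).
- by rewrite vertex_blowup.
- by rewrite deletion_blowup.
- by rewrite link_blowup.
rewrite deletion_blowup; apply/subsetP=> G.
have DA' : vertices D \subset f @: (A :\ y) by rewrite imset_fibre.
move=> /(blowup_facetP _ Dc DA')[GA inj GD]; apply/blowup_facetP=> //; split=> //.
exact: subset_trans GA (subsetDl _ _).
Qed.

(** An expansion of a simplex need not be a simplex. Shedding a point with a twin shrinks [A] in the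
    deletion and [F] in the link, whence the induction on the sum of their sizes. *)
Lemma vertex_decomposable_blowup_powerset A F :
  F \subset f @: A -> vertex_decomposable (blowup A (powerset F)).
Proof.
have [n] := ubnP (#|A| + #|F|); elim: n => // n IHn in A F * => leAF FA.
(* [B] consists of the vertices of the blowup; if [f] is injective on it, the blowup is the full
   simplex on [B]. *)
pose B := A :&: f @^-1: F.
have [/imset_injP inj|/imset_injP ninj] := boolP (#|f @: B| == #|B|).
  apply: vd_simplex; exists B; apply/setP=> G; rewrite [RHS]inE.
  rewrite subsetI -sub_imset_pre; apply/blowupP/andP=> [[GA _]|[GA GF]].
    by rewrite inE.
  split; rewrite ?inE //; apply: (sub_in2 _ inj); apply/subsetP.
  by rewrite subsetI GA -sub_imset_pre.
have /existsP[y /existsP[z /and5P[yA zA yF yz /eqP fyz]]] :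
    [exists y, exists z, [&& y \in A, z \in A, f y \in F, y != z & f y == f z]].
  apply: contraT => nex; case: ninj => y z.
  rewrite !inE => /andP[yA yF] /andP[zA _] fyz; apply/eqP; apply: contraT => yz.
  case/negP: nex; apply/existsP; exists y; apply/existsP; exists z.
  by rewrite yA zA yF yz fyz /=.
have tw : f y \in f @: (A :\ y) by rewrite fyz imset_f // !inE eq_sym yz.
apply: (@blowup_shed_twin _ _ y); rewrite ?vertices_powerset ?link_powerset //.
- exact: simplicial_complex_powerset.
- apply: IHn; last by rewrite imset_fibre.
  by rewrite -ltnS; apply: leq_trans leAF; rewrite (cardsD1 y A) yA.
- apply: IHn; last exact: subset_trans (subsetDl _ _) FA.
  by rewrite -ltnS; apply: leq_trans leAF; rewrite (cardsD1 (f y) F) yF addnCA.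
Qed.

Lemma vertex_decomposable_blowup D : vertex_decomposable D ->
  forall A, simplicial_complex D -> vertices D \subset f @: A ->
  vertex_decomposable (blowup A D).
Proof.
elim=> {D} [D [F ->]|D x xD _ IHdel _ IHlk shed] A Dc DA.
  rewrite vertices_powerset in DA.
  exact: vertex_decomposable_blowup_powerset.
have xDc : [set x] \in D by rewrite inE in xD.
(* An inner induction on [A] for fixed [D]: the points over the shedding vertex [x] are removed one
   by one until a single one is left. *)
have [n] := ubnP #|A|; elim: n => // n IHn in A DA * => leA.
have /imsetP[y yA xy] := subsetP DA _ xD; rewrite {}xy in xD xDc IHdel IHlk shed.
have lk : vertex_decomposable (blowup A (link D [set f y])).
  apply: IHlk; first exact: simplicial_complex_link.
  exact: subset_trans (vertices_sub (link_sub _ _)) DA.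
have [tw|ntw] := boolP (f y \in f @: (A :\ y)).
  apply: (@blowup_shed_twin _ _ y) => //; apply: IHn; first by rewrite imset_fibre.
  by rewrite -ltnS; apply: leq_trans leA; rewrite (cardsD1 y A) yA.
have delc := simplicial_complex_deletion [set f y] Dc.
have delA := vertices_deletion_sub y DA.
apply: (@vd_shedding _ _ y).
- by rewrite vertex_blowup.
- by rewrite deletion_blowup -(blowup_deletion D ntw); apply: IHdel.
- by rewrite link_blowup.
rewrite deletion_blowup -(blowup_deletion D ntw); apply/subsetP=> G.
move=> /(blowup_facetP _ delc delA)[GA inj GD]; apply/blowup_facetP=> //.
split=> //; last exact: (subsetP shed).
exact: subset_trans GA (subsetDl _ _).
Qed.

(** The induction follows the decomposition of [E]; [A] and [D] stay general because deletions and
    links of a blowup are blowups of other data. *)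
Lemma blowup_vertex_decomposable E : vertex_decomposable E ->
  forall A D, E = blowup A D -> simplicial_complex D ->
  vertices D \subset f @: A -> vertex_decomposable D.
Proof.
have lift A D F : simplicial_complex D -> vertices D \subset f @: A -> F \in D ->
    exists G, [/\ G \subset A, {in G &, injective f} & f @: G = F].
  move=> Dc DA FD.
  have [||||G [_ GA inj GF]] := @extend_transversal A set0 F.
  - exact: sub0set.
  - by move=> ? ?; rewrite inE.
  - by rewrite imset0 sub0set.
  - exact: subset_trans (face_sub_vertices Dc FD) DA.
  by exists G.
elim=> {E} [E [B ->]|E y yE _ IHdel _ IHlk shed] A D eE Dc DA.
  have /blowupP[BA inj BD] : B \in blowup A D by rewrite -eE inE.
  (* Every face of [D] lifts to a subset of [B], so [f @: B] is the largest face of [D]. *)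
  apply: vd_simplex; exists (f @: B); apply/setP=> F; rewrite inE.
  apply/idP/idP=> [FD|]; last by case: Dc => _; apply.
  have [G [GA injG GF]] := lift A D F Dc DA FD.
  have : G \in blowup A D by apply/blowupP; rewrite GF.
  by rewrite -eE inE -GF; apply: imsetS.
rewrite {}eE in yE IHdel IHlk shed; rewrite deletion_blowup in IHdel.
have yA : y \in A by move: yE; rewrite !inE sub1set => /andP[].
have xD : f y \in vertices D by rewrite -(vertex_blowup _ yA).
have xDc : [set f y] \in D by rewrite inE in xD.
have [tw|ntw] := boolP (f y \in f @: (A :\ y)).
  by apply: (IHdel _ _ erefl) => //; rewrite imset_fibre.
have delc := simplicial_complex_deletion [set f y] Dc.
have delA := vertices_deletion_sub y DA.
apply: (@vd_shedding _ _ (f y)) => //.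
- by apply: (IHdel (A :\ y)) => //; rewrite blowup_deletion.
- apply: (IHlk _ _ (link_blowup Dc yA)); first exact: simplicial_complex_link.
  exact: subset_trans (vertices_sub (link_sub _ _)) DA.
(* Lift the facet [F] to a facet [G] of the deletion upstairs; there [y] is shedding, so [G] is a
   facet of the blowup and its image [F] is one of [D]. *)
apply/subsetP=> F Fdel.
have FD : F \in deletion D [set f y] by move: Fdel; rewrite inE => /maxsetP[].
have [G [GA inj GF]] := lift _ _ _ delc delA FD.
have : G \in facets (deletion (blowup A D) [set y]).
  rewrite deletion_blowup -(blowup_deletion D ntw).
  by apply/blowup_facetP; rewrite ?GF.
by move=> /(subsetP shed)/(blowup_facetP _ Dc DA)[_ _]; rewrite GF.
Qed.

End Blowup.

(** * The expansion as a blowup along [tag] *)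

Lemma expansion_blowup (V : finType) (s : V -> nat) (D : {set {set V}}) :
    simplicial_complex D -> (forall i, 0 < s i) ->
  expansion s D = blowup (fun u : expansion_vertex s => tag u) setT D.
Proof.
move=> [_ Dsub] s_gt0; apply/setP=> G; rewrite inE.
apply/existsP/blowupP=> [[K /andP[/imset2P[F r Ffac _ ->] GF]]|[_ inj GD]].
  split; first exact: subsetT.
    move=> u v /(subsetP GF)/imsetP[i _ ->] /(subsetP GF)/imsetP[j _ ->] /= ij.
    by rewrite ij.
  have FD : F \in D by move: Ffac; rewrite inE => /maxsetP[].
  by apply: Dsub FD _; rewrite -(tag_lift_face r F); apply: imsetS.
have [F Fmax GF] := @maxset_exists _ (fun H => H \in D) _ GD.
(* Over each vertex, [r] selects the copy that occurs in [G], unique by injectivity of [tag] on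
   [G]. *)
have [r rG] : exists r : forall i, 'I_(s i),
    forall i u, u \in G -> tag u = i -> u = Tagged (fun i => 'I_(s i)) (r i).
  apply: (@fin_all_exists V (fun i => 'I_(s i)) (fun i j =>
    forall u, u \in G -> tag u = i -> u = Tagged (fun i => 'I_(s i)) j)) => i.
  have [/imsetP[u uG ->]|niG] := boolP (i \in [set tag u | u in G]).
    exists (tagged u) => v vG vu.
    by rewrite (inj _ _ vG uG vu); case: (u).
  (* No point of [G] lies over [i], so the first copy is an arbitrary default. *)
  exists (Ordinal (s_gt0 i)) => u uG ui; case/negP: niG.
  by rewrite -ui; apply: imset_f.
exists (lift_face [ffun i => r i] F); apply/andP; split.
  by apply/imset2P; exists F [ffun i => r i]; rewrite ?inE.
apply/subsetP=> u uG; apply/imsetP; exists (tag u).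
  by apply: (subsetP GF); apply: imset_f.
by rewrite ffunE; apply: rG.
Qed.

Theorem theorem2p7 (n : nat) (D : {set {set 'I_n}}) (s : 'I_n -> nat)
    (D_complex : simplicial_complex D) (D_vertices : vertices D = [set: 'I_n])
    (s_gt0 : forall i : 'I_n, 0 < s i) :
  vertex_decomposable D <-> vertex_decomposable (expansion s D).
Proof.
rewrite expansion_blowup //.
have DA : vertices D \subset [set tag u | u in [set: expansion_vertex s]].
  apply/subsetP=> i _; apply/imsetP.
  by exists (Tagged (fun i => 'I_(s i)) (Ordinal (s_gt0 i))).
split=> [vd|vd]; first exact: vertex_decomposable_blowup.
exact: blowup_vertex_decomposable vd _ _ erefl D_complex DA.
Qed.
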